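(* For all integers $p \geq 2$ and $q \geq 1$, the Newman group $$\mathrm{NG}(p,q) = \langle y, x_1, x_2, \dots, x_p \mid y = (y^q)^{x_1} (y^q)^{x_2} \cdots (y^q)^{x_p}\rangle$$ is isomorphic to an index $p$ normal subgroup of the inflated Baumslag–Solitar group $$\mathrm{BS}^{(p)}(1,pq)=\langle a,b \mid (bab^{-1}a^{-pq})^p=1\rangle .$$
   Context: $\langle A \mid R\rangle$ denotes the group presented by generators $A$ and defining relations $R$. Conjugation convention: $u^{v}=vuv^{-1}$, so $(y^q)^{x_i}=x_iy^qx_i^{-1}$. In general, for $k\ge1$ and $m,n\in\mathbb{Z}$, the $k$-fold inflated Baumslag–Solitar group is $\mathrm{BS}^{(k)}(m,n)=\langle a,b\mid (ba^mb^{-1}a^{-n})^k=1\rangle$. *)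

(* Defs.v *)
From HB Require Import structures.
From mathcomp Require Import all_boot all_order all_algebra.
From mathcomp Require Import boolp classical_sets functions cardinality.
Set Implicit Arguments.
Unset Strict Implicit.
Unset Printing Implicit Defensive.

Local Open Scope classical_set_scope.
Local Open Scope group_scope.

(* Unreduced words: (a, true) stands for the letter a and (a, false) for its
   formal inverse. With concatenation and formal inversion they form a
   *-monoid, so that the group notations can be used to write relations. *)
Definition word (A : choiceType) : Type := seq (A * bool).

Section Words.
Variable A : choiceType.

HB.instance Definition _ := Choice.on (word A).

Definition gen (a : A) : word A := [:: (a, true)].

Definition word_mul (u v : word A) : word A := u ++ v.

Definition word_inv (u : word A) : word A :=
  rev [seq (x.1, ~~ x.2) | x <- u].

Lemma word_mulA : associative word_mul. Proof. exact: catA. Qed.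
Lemma word_mul1 : left_id [::] word_mul. Proof. by []. Qed.
Lemma word_invK : involutive word_inv.
Proof.
move=> u; rewrite /word_inv map_rev revK -map_comp -[RHS]map_id.
by apply: eq_map => -[a e] /=; rewrite negbK.
Qed.
Lemma word_invM : {morph word_inv : u v / word_mul u v >-> word_mul v u}.
Proof. by move=> u v; rewrite /word_inv /word_mul map_cat rev_cat. Qed.

HB.instance Definition _ := isStarMonoid.Build (word A)
  word_mulA word_mul1 word_invK word_invM.

End Words.

(* A relation u = v is the pair (u, v). *)
Inductive pres_rel (A : choiceType) (R : set (word A * word A)) :
    word A -> word A -> Prop :=
| pres_rel_def u v : R (u, v) -> pres_rel R u v
| pres_rel_mulV u : pres_rel R (u * u^-1) 1
| pres_rel_mul u u' v v' :
    pres_rel R u u' -> pres_rel R v v' -> pres_rel R (u * v) (u' * v')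
| pres_rel_refl u : pres_rel R u u
| pres_rel_sym u v : pres_rel R u v -> pres_rel R v u
| pres_rel_trans u v w :
    pres_rel R u v -> pres_rel R v w -> pres_rel R u w.

Section Presentation.
Variables (A : choiceType) (R : set (word A * word A)).

Definition pres_relb : rel (word A) := fun u v => `[< pres_rel R u v >].

Lemma pres_relb_refl : reflexive pres_relb.
Proof. by move=> u; apply/asboolP/pres_rel_refl. Qed.
Lemma pres_relb_sym : symmetric pres_relb.
Proof.
by move=> u v; apply/asboolP/asboolP => H; apply: pres_rel_sym.
Qed.
Lemma pres_relb_trans : transitive pres_relb.
Proof.
move=> v u w /asboolP uv /asboolP vw; apply/asboolP.
exact: pres_rel_trans uv vw.
Qed.

Canonical pres_equiv :=
  EquivRel pres_relb pres_relb_refl pres_relb_sym pres_relb_trans.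

Definition presented : Type := {eq_quot pres_equiv}%qT.

HB.instance Definition _ := Choice.on presented.
HB.instance Definition _ := EqQuotient.on presented.

Local Open Scope quotient_scope.

Definition pres_class (u : word A) : presented := \pi_presented u.

Definition pres_one : presented := pres_class 1.
Definition pres_mul (x y : presented) : presented :=
  pres_class (repr x * repr y).
Definition pres_inv (x : presented) : presented := pres_class (repr x)^-1.

Lemma pres_classP u v : pres_class u = pres_class v <-> pres_rel R u v.
Proof.
split=> [/eqmodP /asboolP //|H]; apply/eqmodP; exact/asboolP.
Qed.

Lemma pres_reprK x : pres_class (repr x) = x. Proof. exact: reprK. Qed.

Lemma pres_repr_class u : pres_rel R (repr (pres_class u)) u.
Proof. by apply/pres_classP; rewrite pres_reprK. Qed.

Lemma pres_rel_Vmul u : pres_rel R (u^-1 * u) 1.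
Proof. by rewrite -{2}[u]invgK; apply: pres_rel_mulV. Qed.

Lemma pres_rel_inv u v : pres_rel R u v -> pres_rel R u^-1 v^-1.
Proof.
move=> uv; apply: (@pres_rel_trans _ _ _ (u^-1 * (v * v^-1))).
  rewrite -{1}[u^-1]mulg1.
  exact: pres_rel_mul (pres_rel_refl _ _) (pres_rel_sym (pres_rel_mulV _ _)).
apply: (@pres_rel_trans _ _ _ (u^-1 * (u * v^-1))).
  apply: pres_rel_mul; first exact: pres_rel_refl.
  by apply: pres_rel_mul; [exact: pres_rel_sym | exact: pres_rel_refl].
rewrite mulgA -[X in pres_rel _ _ X]mul1g.
exact: pres_rel_mul (pres_rel_Vmul _) (pres_rel_refl _ _).
Qed.

Lemma pres_class_mul u v :
  pres_mul (pres_class u) (pres_class v) = pres_class (u * v).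
Proof. by apply/pres_classP/pres_rel_mul; apply: pres_repr_class. Qed.

Lemma pres_class_inv u : pres_inv (pres_class u) = pres_class u^-1.
Proof. exact/pres_classP/pres_rel_inv/pres_repr_class. Qed.

Lemma pres_mulA : associative pres_mul.
Proof.
move=> x y z; rewrite -[x]pres_reprK -[y]pres_reprK -[z]pres_reprK.
by rewrite !pres_class_mul mulgA.
Qed.
Lemma pres_mul1 : left_id pres_one pres_mul.
Proof. by move=> x; rewrite -[x]pres_reprK pres_class_mul mul1g. Qed.
Lemma pres_mulr1 : right_id pres_one pres_mul.
Proof. by move=> x; rewrite -[x]pres_reprK pres_class_mul mulg1. Qed.
Lemma pres_mulV : left_inverse pres_one pres_inv pres_mul.
Proof.
move=> x; rewrite -[x]pres_reprK pres_class_inv pres_class_mul.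
exact/pres_classP/pres_rel_Vmul.
Qed.
Lemma pres_mulrV : right_inverse pres_one pres_inv pres_mul.
Proof.
move=> x; rewrite -[x]pres_reprK pres_class_inv pres_class_mul.
exact/pres_classP/pres_rel_mulV.
Qed.

HB.instance Definition _ := isGroup.Build presented
  pres_mulA pres_mul1 pres_mulr1 pres_mulV pres_mulrV.

Lemma pres_classM : {morph pres_class : u v / u * v}.
Proof. by move=> u v; rewrite -pres_class_mul. Qed.
Lemma pres_class1 : pres_class 1 = 1. Proof. by []. Qed.
Lemma pres_classV : {morph pres_class : u / u^-1}.
Proof. by move=> u; rewrite -pres_class_inv. Qed.

Lemma pres_class_rel u v : R (u, v) -> pres_class u = pres_class v.
Proof. by move=> Ruv; apply/pres_classP/pres_rel_def. Qed.

End Presentation.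

Section UniversalProperty.
Variables (A : choiceType) (R : set (word A * word A)).
Variables (G : groupType) (f : A -> G).

Definition word_eval (u : word A) : G :=
  \prod_(x <- u) (if x.2 then f x.1 else (f x.1)^-1).

Lemma word_eval_gen a : word_eval (gen a) = f a.
Proof. by rewrite /word_eval big_seq1. Qed.

Lemma word_evalM : {morph word_eval : u v / u * v}.
Proof. by move=> u v; rewrite /word_eval big_cat. Qed.

Lemma word_eval1 : word_eval 1 = 1.
Proof. by rewrite /word_eval big_nil. Qed.

Lemma word_evalV : {morph word_eval : u / u^-1}.
Proof.
elim=> [|[a e] u IHu]; first by rewrite [LHS]word_eval1 word_eval1 invg1.
rewrite -[_ :: u]/(([:: (a, e)] : word A) * u) invgM !word_evalM IHu invgM.
congr (_ * _); rewrite /word_eval !big_seq1 /=.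
by case: e; rewrite ?invgK.
Qed.

Lemma pres_lift : (forall u v, R (u, v) -> word_eval u = word_eval v) ->
  exists! phi : {multiplicative presented R -> G},
    forall a, phi (pres_class R (gen a)) = f a.
Proof.
move=> Rf.
have ev u v : pres_rel R u v -> word_eval u = word_eval v.
  elim=> {u v} [u v /Rf //|u|u u' v v' _ Hu _ Hv|//|u v _ -> //|u v w _ -> _ //].
    by rewrite word_evalM word_evalV mulgV word_eval1.
  by rewrite !word_evalM Hu Hv.
pose h (x : presented R) := word_eval (repr x).
have hc u : h (pres_class R u) = word_eval u by apply: ev; exact: pres_repr_class.
have hM : {morph h : x y / x * y}.
  move=> x y; rewrite -[x]pres_reprK -[y]pres_reprK -pres_classM !hc.
  exact: word_evalM.
pose H := isMultiplicative.Build _ _ h hM.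
pose phi : {multiplicative presented R -> G} := HB.pack h H.
exists phi; split=> [a|psi psif]; first by rewrite /= hc word_eval_gen.
suff E : h = psi.
  case: psi psif E => g [[gM]] /= _ E; move: gM; rewrite -E => gM.
  by rewrite /phi /H (Prop_irrelevance hM gM).
have psi1 : psi 1 = 1.
  by apply: (@mulgI _ (psi 1)); rewrite -gmulfM !mulg1.
have psiV x : psi x^-1 = (psi x)^-1.
  by apply: (@mulgI _ (psi x)); rewrite -gmulfM !mulgV.
apply/funext => x; rewrite -[x]pres_reprK hc.
set u := repr x; elim: u => [|[a e] u IHu].
  by rewrite word_eval1 -[[::]]/(1 : word A) pres_class1 psi1.
rewrite -[_ :: u]/(([:: (a, e)] : word A) * u) word_evalM pres_classM gmulfM -IHu.
congr (_ * _); case: e; rewrite /word_eval big_seq1 /=; first by rewrite -psif.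
by rewrite -[[:: _]]/((gen a)^-1) pres_classV psiV psif.
Qed.

End UniversalProperty.

Section Subgroups.
Variable G : groupType.

Definition subgroup (H : groupClosed G) : Type := {x : G | x \in H}.

HB.instance Definition _ (H : groupClosed G) := SubChoice.on (subgroup H).

Lemma groupClosed_closed (H : groupClosed G) : group_closed H.
Proof. by split; [exact: gpred1 | exact: gpredF]. Qed.

HB.instance Definition _ (H : groupClosed G) :=
  SubChoice_isSubGroup.Build G (fun x => x \in H) (subgroup H)
    (groupClosed_closed H).

Definition normal_subgroup (H : groupClosed G) : Prop :=
  forall g h : G, h \in H -> g * h * g^-1 \in H.

Definition left_coset (H : groupClosed G) (g : G) : set G :=
  [set g * h | h in [set` H]].

Definition has_index (H : groupClosed G) (n : nat) : Prop :=
  (range (left_coset H) #= `I_n)%card.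

End Subgroups.

Definition isomorphic (G K : groupType) : Prop :=
  exists f : {multiplicative G -> K}, bijective f.

(* Note that u ^ v in the library is v^-1 * u * v. *)
Definition lconj (G : baseGroupType) (u v : G) : G := v * u * v^-1.

Definition expgz (G : baseGroupType) (u : G) (n : int) : G :=
  match n with Posz k => u ^+ k | Negz k => u ^- k.+1 end.

(* None is the generator y; Some i, for i : 'I_p, is the generator x_(i+1). *)
Definition NG_relation (p q : nat) :
    word (option 'I_p) * word (option 'I_p) :=
  let y := gen None in
  let x i := gen (Some i) in
  (y, \prod_(i < p) lconj (y ^+ q) (x i)).

Definition NG (p q : nat) : groupType := presented [set NG_relation p q].

(* true is the generator a, false is the generator b. *)
Definition BS_relation (k : nat) (m n : int) : word bool * word bool :=
  let a := gen true in
  let b := gen false in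
  ((b * expgz a m * b^-1 * expgz a (- n)%R) ^+ k, 1).

Definition BS (k : nat) (m n : int) : groupType :=
  presented [set BS_relation k m n].

(* Main.v *)
Require Import Defs.
From HB Require Import structures.
From mathcomp Require Import all_boot all_order all_algebra all_fingroup.
From mathcomp Require Import boolp classical_sets functions cardinality.

(** Write [B] for the inflated Baumslag-Solitar group with generators [a], [b],
and [N] for the Newman group with generators [y], [x_0, ..., x_(p-1)]. The
relator of [B] is a [p]-th power, so that [a |-> 1], [b |-> 0] defines a
surjection [phi] from [B] onto [Z/p], and the subgroup is its kernel. Schreier's method with the transversal [1, a, ..., a^(p-1)] suggests
the generators [y = a^-p] and [x_i = a^i b^-1 a^-i] for it. With these values,
  [prod_(i < p) x_i y^q x_i^-1 = prod_(i < p) a^i (b^-1 a^-pq b) a^-i]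
telescopes to [(b^-1 a^-pq b a)^p a^-p] ([prod_Newman]). As
[b^-1 a^-pq b a] is conjugate to [b a b^-1 a^-pq], in every group
the relation of [N] for these [y], [x_i] amounts to the relation of [B] for
[a], [b]. This gives a morphism [F] from [N] to [B] ([Newman_hom]).

That [F] is an isomorphism onto the kernel is shown without rewriting words:
the inverse is read off from the Kaloujnine-Krasner embedding of an extension
of [Z/p] by [N] into the regular wreath product of [N] by [Z/p]. One writes down
the images of [a] and [b] under that embedding; the equivalence above, used now
inside the wreath product, reduces the relation of [B] for these two elements
to the relation of [N] at a single coordinate ([wreath_relation]), which
produces a morphism [rho] on [B] whose top component is [phi]. On the kernel of
[phi] the coordinate of [rho] at the neutral element [0] is multiplicative. It inverts [F] on the
left, by inspection of the generators of [N], and on the right because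
  [F (rho(g)_i) = a^i g a^-(i + phi(g))],
exponents of [a] being representatives in [0, ..., p-1], an identity that
passes from the generators [a], [b] to all [g] ([coord_transfer]). *)

Set Implicit Arguments.
Unset Strict Implicit.
Unset Printing Implicit Defensive.

Local Open Scope group_scope.

(** * Morphisms out of a presented group *)

Section WordEvaluation.
Variables (A : choiceType) (R : set (word A * word A)).

HB.instance Definition _ (G : groupType) (f : A -> G) :=
  isMultiplicative.Build (word A) G (word_eval f) (word_evalM f).
HB.instance Definition _ (G : groupType) (f : A -> G) :=
  Multiplicative_isUMagmaMorphism.Build (word A) G (word_eval f)
    (word_eval1 f).

Lemma pres_class_eval (u : word A) :
  pres_class R u = word_eval (fun a => pres_class R (gen a)) u.
Proof.
elim: u => [|[a e] u IHu]; first by rewrite [RHS]word_eval1.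
rewrite -[_ :: u]/(([:: (a, e)] : word A) * u) pres_classM word_evalM IHu.
congr (_ * _); rewrite /word_eval big_seq1.
by case: e => //=; rewrite -pres_classV.
Qed.

Lemma pres_ind (P : presented R -> Prop) :
  (forall a, P (pres_class R (gen a))) -> P 1 ->
  (forall g h, P g -> P h -> P (g * h)) -> (forall g, P g -> P g^-1) ->
  forall g, P g.
Proof.
move=> Pgen P1 PM PV g; rewrite -[g]pres_reprK pres_class_eval /word_eval.
by apply: (big_ind P) => // -[a []] _ //=; apply: PV.
Qed.

(** The existence part of the universal property, with the unit law packed in
so that the theory of group morphisms applies. *)
Lemma pres_hom (G : groupType) (f : A -> G) :
  (forall u v, R (u, v) -> word_eval f u = word_eval f v) ->
  exists phi : UMagmaMorphism.type (presented R) G,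
    forall a, phi (pres_class R (gen a)) = f a.
Proof.
move=> /pres_lift [phi [phif _]].
have phi1 : phi 1 = 1 by apply: (mulgI (phi 1)); rewrite -gmulfM !mulg1.
pose H1 := Multiplicative_isUMagmaMorphism.Build _ _ (phi : _ -> _) phi1.
pose psi : UMagmaMorphism.type (presented R) G :=
  HB.pack (phi : _ -> _) H1 (Multiplicative.class phi).
by exists psi.
Qed.

End WordEvaluation.

(** * The two relations in an arbitrary group *)

Lemma gmulf_lconj (G K : groupType) (f : UMagmaMorphism.type G K) :
  {morph f : u v / lconj u v}.
Proof. by move=> u v; rewrite /lconj !gmulfM gmulfV. Qed.

Section Relations.
Variable G : groupType.

Lemma expgzN (S : starMonoidType) (u : S) n :
  expgz u (- Posz n)%R = u ^- n.
Proof. by case: n => //=; rewrite expg0 invg1. Qed.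

Lemma BS_relationE (g : bool -> G) k n :
  word_eval g (BS_relation k 1 (Posz n)).1 =
  (g false * g true * (g false)^-1 * g true ^- n) ^+ k.
Proof.
rewrite /BS_relation expgzN /= gmulfXn !gmulfM /=.
by rewrite expg1 !word_evalV gmulfXn /= !word_eval_gen.
Qed.

Lemma NG_relationE p q (g : option 'I_p -> G) :
  word_eval g (NG_relation p q).2 =
  \prod_(i < p) lconj (g None ^+ q) (g (Some i)).
Proof.
rewrite gmulf_prod; apply: eq_bigr => i _.
by rewrite /lconj !gmulfM gmulfXn /= word_evalV !word_eval_gen.
Qed.

(** Neighbouring factors telescope, [a^-i a^(i+1) = a]. *)
Lemma prod_lconjX (a u : G) n :
  \prod_(i < n) lconj u (a ^+ i) = (u * a) ^+ n * a ^- n.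
Proof.
elim: n => [|n IHn]; first by rewrite big_ord0 !expg0 invg1 mulg1.
rewrite big_ord_recr /= IHn /lconj !expgSr invgM !mulgA.
by rewrite mulgVK mulgK.
Qed.

Lemma BS_relator_conj (a b : G) k n :
  (b * a * b^-1 * a ^- n) ^+ k = 1 <-> (b^-1 * a ^- n * b * a) ^+ k = 1.
Proof.
have -> : b * a * b^-1 * a ^- n = (b^-1 * a ^- n * b * a) ^ (b^-1 * a ^- n).
  by rewrite /conjg invgM !invgK !mulgA mulgK mulgV mul1g.
by rewrite -conjXg; split=> [/eqP|->]; rewrite ?conj1g // conjg_eq1 => /eqP.
Qed.

(** With [y = a^-p] and [x_i = a^i b^-1 a^-i], the power [y^q] commutes with
[a^i], so that the [i]-th factor is the conjugate by [a^i] of one and the same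
element [b^-1 a^-pq b]. *)
Lemma prod_Newman (a b : G) p q :
  \prod_(i < p) lconj (a ^- p ^+ q) (lconj b^-1 (a ^+ i)) =
  (b^-1 * a ^- (p * q) * b * a) ^+ p * a ^- p.
Proof.
rewrite -prod_lconjX; apply: eq_bigr => i _.
have aC : commute (a ^+ i) (a ^- p ^+ q).
  by apply/commuteX/commuteV/commuteX2.
rewrite /lconj !invgM !invgK !mulgA.
rewrite -(mulgA _ _ (a ^+ i)) -aC mulgA mulgVK.
by rewrite expVgn -expgnA.
Qed.

End Relations.

(** * The regular wreath product *)

(** The second component is the family of coordinates in [N]; [C] permutes them
by right translation. *)
Definition wreath (N : groupType) (C : finGroupType) : Type :=
  (C * {ffun C -> N})%type.

Section WreathProduct.
Variables (N : groupType) (C : finGroupType).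

HB.instance Definition _ := Choice.on (wreath N C).

Definition wreath_one : wreath N C := (1, [ffun=> 1]).
Definition wreath_mul (v w : wreath N C) : wreath N C :=
  (v.1 * w.1, [ffun i => v.2 i * w.2 (i * v.1)]).
Definition wreath_inv (w : wreath N C) : wreath N C :=
  (w.1^-1, [ffun i => (w.2 (i * w.1^-1))^-1]).

Lemma wreath_mulA : associative wreath_mul.
Proof.
move=> u v w; congr pair; rewrite /= ?mulgA //.
by apply/ffunP=> i; rewrite !ffunE !mulgA.
Qed.
Lemma wreath_mul1 : left_id wreath_one wreath_mul.
Proof.
case=> s c; congr pair; rewrite /= ?mul1g //.
by apply/ffunP=> i; rewrite !ffunE mul1g mulg1.
Qed.
Lemma wreath_mulr1 : right_id wreath_one wreath_mul.
Proof.
case=> s c; congr pair; rewrite /= ?mulg1 //.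
by apply/ffunP=> i; rewrite !ffunE mulg1.
Qed.
Lemma wreath_mulV : left_inverse wreath_one wreath_inv wreath_mul.
Proof.
case=> s c; congr pair; rewrite /= ?mulVg //.
by apply/ffunP=> i; rewrite !ffunE mulVg.
Qed.
Lemma wreath_mulrV : right_inverse wreath_one wreath_inv wreath_mul.
Proof.
case=> s c; congr pair; rewrite /= ?mulgV //.
by apply/ffunP=> i; rewrite !ffunE mulgK mulgV.
Qed.

HB.instance Definition _ := isGroup.Build (wreath N C)
  wreath_mulA wreath_mul1 wreath_mulr1 wreath_mulV wreath_mulrV.

Definition wreath_top (w : wreath N C) : C := w.1.

Lemma wreath_topM : {morph wreath_top : v w / v * w}. Proof. by []. Qed.

HB.instance Definition _ :=
  isMultiplicative.Build (wreath N C) C wreath_top wreath_topM.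
HB.instance Definition _ :=
  Multiplicative_isUMagmaMorphism.Build (wreath N C) C wreath_top (erefl 1).

Lemma wreath_ext (v w : wreath N C) :
  wreath_top v = wreath_top w -> v.2 =1 w.2 -> v = w.
Proof.
by case: v w => [s c] [t d]; rewrite /wreath_top /= => -> /ffunP->.
Qed.

Lemma wreath_topV (w : wreath N C) : wreath_top w^-1 = (wreath_top w)^-1.
Proof. by []. Qed.

Lemma wreath_topX (w : wreath N C) n :
  wreath_top (w ^+ n) = wreath_top w ^+ n.
Proof. by rewrite gmulfXn. Qed.

Lemma wreath_top_lconj (v w : wreath N C) :
  wreath_top v = 1 -> wreath_top (lconj v w) = 1.
Proof. by rewrite !wreath_topM wreath_topV => ->; rewrite mulg1 mulgV. Qed.

Lemma wreath_coordM (v w : wreath N C) i :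
  (v * w).2 i = v.2 i * w.2 (i * wreath_top v).
Proof. by rewrite ffunE. Qed.

Lemma wreath_coordV (w : wreath N C) i :
  w^-1.2 i = (w.2 (i * (wreath_top w)^-1))^-1.
Proof. by rewrite ffunE. Qed.

Lemma wreath_coordX (w : wreath N C) k i :
  wreath_top w = 1 -> (w ^+ k).2 i = w.2 i ^+ k.
Proof.
move=> w1; elim: k => [|k IHk]; first by rewrite !expg0 ffunE.
by rewrite !expgS wreath_coordM w1 mulg1 IHk.
Qed.

Lemma wreath_coord_lconj (v w : wreath N C) i :
  wreath_top v = 1 -> (lconj v w).2 i = lconj (v.2 (i * wreath_top w)) (w.2 i).
Proof.
move=> v1; rewrite !wreath_coordM wreath_coordV wreath_topM v1 mulg1.
by rewrite mulgK.
Qed.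

Lemma wreath_coord_prod n (F : 'I_n -> wreath N C) i :
  (forall j, wreath_top (F j) = 1) ->
  (\prod_(j < n) F j).2 i = \prod_(j < n) (F j).2 i.
Proof.
move=> F1; suff [] : (\prod_(j < n) F j).2 i = \prod_(j < n) (F j).2 i /\
  wreath_top (\prod_(j < n) F j) = 1 by [].
elim/big_rec2: _ => [|j g w _ [<- w1]].
  by rewrite ffunE.
by rewrite wreath_topM w1 wreath_coordM F1 !mulg1.
Qed.

(** For [v] in the base group, the coordinate of [w * v * w^-1] at [i] is a
conjugate in [N] of the coordinate of [v] at [i * wreath_top w]. If [v] commutes
with [w], triviality thus spreads from one point to its orbit under the top
component of [w]. *)
Lemma wreath_commute_coord1 (v w : wreath N C) k :
  commute v w -> wreath_top v = 1 -> v.2 1 = 1 -> v.2 (wreath_top w ^+ k) = 1.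
Proof.
move=> vw v1 v11; elim: k => [|k IHk]; first by rewrite expg0.
have /(congr1 (fun u : wreath N C => u.2 (wreath_top w ^+ k))) := vw.
rewrite !wreath_coordM v1 mulg1 IHk mul1g expgSr => /esym E.
by apply: (mulgI (w.2 (wreath_top w ^+ k))); rewrite E mulg1.
Qed.

End WreathProduct.

(** * Kernels of morphisms onto a finite group *)

Section Kernel.
Variables (G : groupType) (C : finGroupType) (phi : UMagmaMorphism.type G C).

Definition kernel : {pred G} := fun g => phi g == 1.

Lemma kernelE g : (g \in kernel) = (phi g == 1). Proof. by []. Qed.

Lemma kernelM : mulg_closed kernel.
Proof.
by move=> g h; rewrite !kernelE gmulfM => /eqP-> /eqP->; rewrite mulg1.
Qed.
Lemma kernel1 : 1 \in kernel. Proof. by rewrite kernelE gmulf1. Qed.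
Lemma kernelV : invg_closed kernel.
Proof. by move=> g; rewrite !kernelE gmulfV invg_eq1. Qed.

HB.instance Definition _ := isMulClosed.Build G kernel kernelM.
HB.instance Definition _ := isMul1Closed.Build G kernel kernel1.
HB.instance Definition _ := isInvClosed.Build G kernel kernelV.

Lemma kernel_normal : normal_subgroup kernel.
Proof.
move=> g h; rewrite !kernelE !gmulfM gmulfV => /eqP->.
by rewrite mulg1 mulgV.
Qed.

(** The left cosets of the kernel are the fibres of the morphism. *)
Lemma kernel_index : (forall c, exists g, phi g = c) -> has_index kernel #|C|.
Proof.
move=> phi_surj; rewrite /has_index.
pose h c := left_coset kernel (sval (cid (phi_surj c))).
have cosetP g g' : (left_coset kernel g g' <-> phi g = phi g').
  split=> [[k /= /eqP phik <-]|E]; first by rewrite gmulfM phik mulg1.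
  exists (g^-1 * g'); last by rewrite mulVKg.
  by rewrite /= kernelE gmulfM gmulfV E mulVg.
have -> : range (left_coset kernel) = range h.
  apply/seteqP; split=> _ [g _ <-]; last by exists (sval (cid (phi_surj g))).
  exists (phi g) => //; apply/seteqP; rewrite /h; case: cid => g' /= E.
  by split=> k /cosetP => H; apply/cosetP; congruence.
have h_inj : injective h.
  rewrite /h => c d; case: cid => g /= <-; case: cid => g' /= <- E.
  apply/esym/cosetP; rewrite -E; exact/cosetP.
apply: (card_eq_trans (inj_card_eq (in2W h_inj))).
apply: card_eq_trans (card_esym card_II).
apply: (card_eq_trans (card_esym (inj_card_eq (in2W (@enum_rank_inj C))))).
suff -> : range (@enum_rank C) = setT by [].
by apply/seteqP; split=> // i _; exists (enum_val i) => //; rewrite enum_valK.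
Qed.

End Kernel.

Lemma isomorphic_image (N G : groupType) (F : UMagmaMorphism.type N G)
    (H : groupClosed G) :
  injective F -> (forall n, F n \in H) ->
  (forall h, h \in H -> exists n, F n = h) ->
  isomorphic N (subgroup H).
Proof.
move=> Finj FH Fsurj.
pose f n : subgroup H := Sub (F n) (FH n).
have fM : {morph f : m n / m * n}.
  by move=> m n; apply: val_inj; rewrite /= gmulfM.
have fP (h : subgroup H) : exists n, f n = h.
  by have [n Fn] := Fsurj _ (valP h); exists n; apply: val_inj.
pose f' h := sval (cid (fP h)).
have fK : cancel f' f by move=> h; rewrite /f'; case: cid.
pose M := isMultiplicative.Build _ _ f fM.
exists (HB.pack f M : {multiplicative N -> subgroup H}).
exists f' => //= n; apply: Finj.
by have /(congr1 val) := fK (f n).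
Qed.

(** * The Newman group inside the inflated Baumslag-Solitar group *)

(** Here [p.+1] is the number of generators [x_i], which makes ['I_p.+1] a group
for addition modulo [p.+1]. *)
Section NewmanGroup.
Variables p q : nat.

Local Notation N := (NG p.+1 q).
Local Notation B := (BS p.+1 1 (Posz (p.+1 * q))).
Local Notation C := 'I_p.+1.
Local Notation y := (pres_class [set NG_relation p.+1 q] (gen None) : N).
Local Notation x i :=
  (pres_class [set NG_relation p.+1 q] (gen (Some i)) : N).
Local Notation a :=
  (pres_class [set BS_relation p.+1 1 (Posz (p.+1 * q))] (gen true) : B).
Local Notation b :=
  (pres_class [set BS_relation p.+1 1 (Posz (p.+1 * q))] (gen false) : B).

Lemma NG_hom (G : groupType) (g : option C -> G) :
  g None = \prod_(i < p.+1) lconj (g None ^+ q) (g (Some i)) ->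
  exists phi : UMagmaMorphism.type N G,
    phi y = g None /\ forall i, phi (x i) = g (Some i).
Proof.
move=> gR; have [u v [-> ->]|phi phig] := @pres_hom _ [set NG_relation p.+1 q] G g.
  by rewrite word_eval_gen gR NG_relationE.
by exists phi.
Qed.

Lemma BS_hom (G : groupType) (s t : G) :
  (t * s * t^-1 * s ^- (p.+1 * q)) ^+ p.+1 = 1 ->
  exists phi : UMagmaMorphism.type B G, phi a = s /\ phi b = t.
Proof.
move=> stR; pose g c := if c then s else t.
have [u v [-> ->]|phi phig] :=
    @pres_hom _ [set BS_relation p.+1 1 (Posz (p.+1 * q))] G g.
  by rewrite BS_relationE stR word_eval1.
by exists phi.
Qed.

Lemma NG_relation_holds : y = \prod_(i < p.+1) lconj (y ^+ q) (x i).
Proof.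
have := @pres_class_rel _ [set NG_relation p.+1 q] _ _ (erefl _).
by rewrite [RHS]pres_class_eval NG_relationE.
Qed.

Lemma BS_relation_holds :
  (b * a * b^-1 * a ^- (p.+1 * q)) ^+ p.+1 = 1.
Proof.
have := @pres_class_rel _ [set BS_relation p.+1 1 (Posz (p.+1 * q))] _ _ (erefl _).
by rewrite pres_class_eval BS_relationE => ->.
Qed.

Lemma Newman_hom : exists F : UMagmaMorphism.type N B,
  F y = a ^- p.+1 /\ forall i, F (x i) = lconj b^-1 (a ^+ i).
Proof.
pose g (z : option C) : B :=
  if z is Some i then lconj b^-1 (a ^+ i) else a ^- p.+1.
apply: (@NG_hom B g); rewrite /= prod_Newman.
by have /BS_relator_conj -> := BS_relation_holds; rewrite mul1g.
Qed.

Local Notation W := (wreath N C).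

(** Right multiplication by [a] sends the coset representative [a^i] to
[a^(i+1)], except for the last one, sent to [a^(p+1) = y^-1]; [b] sends [a^i] to
[x_i^-1 a^i]. The two elements below record these Schreier factors. *)
Definition carry (i : C) : N := if i.+1 < p.+1 then 1 else y^-1.
Definition wreath_a : W := (inZp 1, [ffun i => carry i]).
Definition wreath_b : W := (1, [ffun i => (x i)^-1]).

Lemma wreath_top_a : wreath_top wreath_a = inZp 1. Proof. by []. Qed.
Lemma wreath_top_b : wreath_top wreath_b = 1. Proof. by []. Qed.

Lemma Zp_gen_expg k : (inZp 1 : C) ^+ k = inZp k.
Proof. by rewrite Zp_expg; apply: val_inj; rewrite /= modnMml mul1n. Qed.

(** Within [p.+1] steps the index passes the end of the range at most once, and
the factor [y^-1] appears exactly when it does. *)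
Lemma wreath_aX k (i : C) : k <= p.+1 ->
  (wreath_a ^+ k).2 i = if i + k < p.+1 then 1 else y^-1.
Proof.
elim: k => [_|k IHk le_kp]; first by rewrite addn0 ltn_ord expg0 ffunE.
rewrite expgSr wreath_coordM (IHk (ltnW le_kp)) wreath_topX.
rewrite wreath_top_a Zp_gen_expg ffunE /carry /= modnDmr addnS.
have lt_ip := ltn_ord i.
have [lt_ikp|le_pik] := ltnP (i + k) p.+1; first by rewrite modn_small // mul1g.
rewrite [RHS]ifN; last by rewrite -leqNgt leqW.
have lt_p : i + k - p.+1 < p by rewrite ltn_subLR // -addSn leq_add.
have -> : ((i + k) %% p.+1 = i + k - p.+1)%N.
  by rewrite -{1}(subnK le_pik) modnDr modn_small // ltnW.
by rewrite ltnS lt_p mulg1.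
Qed.

Lemma wreath_top_y : wreath_top (wreath_a ^- p.+1) = 1.
Proof.
rewrite wreath_topV wreath_topX wreath_top_a Zp_gen_expg.
by apply: val_inj; rewrite /= modnn subn0 modnn.
Qed.

Lemma wreath_coord_y i : (wreath_a ^- p.+1).2 i = y.
Proof.
by rewrite wreath_coordV wreath_aX // ifN ?invgK // -leqNgt leq_addl.
Qed.

Lemma wreath_top_x i :
  wreath_top (lconj wreath_b^-1 (wreath_a ^+ i)) = 1.
Proof. by rewrite wreath_top_lconj // wreath_topV wreath_top_b invg1. Qed.

Lemma wreath_coord_x (i : C) :
  (lconj wreath_b^-1 (wreath_a ^+ i)).2 1 = x i.
Proof.
rewrite wreath_coord_lconj; last by rewrite wreath_topV wreath_top_b invg1.
rewrite wreath_aX ?(ltnW (ltn_ord i)) // add0n ltn_ord.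
rewrite wreath_topX wreath_top_a Zp_gen_expg valZpK mul1g.
rewrite wreath_coordV wreath_top_b invg1 mulg1 ffunE invgK.
by rewrite /lconj invg1 mulg1 mul1g.
Qed.

(** The conjugate [w] of the relator satisfies [w^(p+1) y = prod x_i y^q x_i^-1]
for the elements of the wreath product that stand for [y] and the [x_i]. Those
have coordinates [y] and [x_i] at the neutral element [1] of the cyclic group,
which is the residue 0, so the Newman relation kills the coordinate of [w^(p+1)] there; the other coordinates follow because the top
component of [w] generates the cyclic group. *)
Lemma wreath_relation :
  (wreath_b * wreath_a * wreath_b^-1 * wreath_a ^- (p.+1 * q)) ^+ p.+1 = 1.
Proof.
apply/BS_relator_conj; set w := _ * wreath_a.
have top_w : wreath_top w = inZp 1.
  rewrite /w expgnA -expVgn !wreath_topM wreath_topX wreath_top_y.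
  by rewrite wreath_topV wreath_top_b expg1n invg1 !mul1g.
have top_wp : wreath_top (w ^+ p.+1) = 1.
  apply: invg_inj; rewrite -wreath_topV invg1 -wreath_top_y.
  by rewrite !wreath_topV !wreath_topX top_w.
have wp1 : (w ^+ p.+1).2 1 = 1.
  apply: (@mulIg _ y); rewrite mul1g -{1}(wreath_coord_y 1).
  have /(congr1 (fun v : W => v.2 1)) := prod_Newman wreath_a wreath_b p.+1 q.
  rewrite [in RHS]wreath_coordM top_wp mulg1 => <-.
  have top_yq : wreath_top (wreath_a ^- p.+1 ^+ q) = 1.
    by rewrite wreath_topX wreath_top_y expg1n.
  rewrite wreath_coord_prod => [|i]; last exact: wreath_top_lconj.
  rewrite [RHS]NG_relation_holds; apply: eq_bigr => i _.
  rewrite wreath_coord_lconj // wreath_coord_x.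
  by rewrite wreath_coordX ?wreath_coord_y ?wreath_top_y.
apply: wreath_ext => // i; rewrite ffunE.
have w_wp : commute (w ^+ p.+1) w by apply/commute_sym/commuteX.
have /(_ i) := wreath_commute_coord1 _ w_wp top_wp wp1.
by rewrite top_w Zp_gen_expg valZpK.
Qed.

(** The right-hand side is the family of Schreier factors of [g] for the
transversal formed by the [a^i]. Both sides are multiplicative in [g] in the
same twisted way, which leaves the generators [a] and [b] to compare. *)
Lemma coord_transfer (rho : UMagmaMorphism.type B W)
    (F : UMagmaMorphism.type N B) :
  rho a = wreath_a -> rho b = wreath_b ->
  F y = a ^- p.+1 -> (forall i, F (x i) = lconj b^-1 (a ^+ i)) ->
  forall g (i : C),
  F ((rho g).2 i) = a ^+ i * g * a ^- ((i * wreath_top (rho g))%g : C).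
Proof.
move=> rho_a rho_b Fy Fx g i.
elim/pres_ind: g i => [[]||g h IHg IHh|g IHg] i.
- rewrite rho_a wreath_top_a ffunE /carry.
  have -> : (i * inZp 1)%g = inZp i.+1 :> C.
    by apply: val_inj; rewrite /= modnDmr addn1.
  rewrite /=.
  have [lt_ip|le_pi] := ltnP i.+1 p.+1.
    by rewrite modn_small // expgSr mulgV gmulf1.
  (* The successor of the last index wraps around to 0, where [a ^+ 0 = 1]. *)
  have ip : i.+1 = p.+1 by apply/eqP; rewrite eqn_leq ltn_ord le_pi.
  by rewrite -expgSr ip modnn expg0 invg1 mulg1 gmulfV /= Fy invgK.
- rewrite rho_b wreath_top_b ffunE mulg1 gmulfV Fx.
  by rewrite /lconj !invgM !invgK mulgA.
- by rewrite gmulf1 ffunE !mulg1 gmulf1 mulgV.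
- rewrite [rho _]gmulfM wreath_coordM gmulfM IHg IHh wreath_topM !mulgA.
  by rewrite mulgVK.
- rewrite gmulfV wreath_coordV gmulfV IHg wreath_topV mulgVK !invgM invgK.
  by rewrite !mulgA.
Qed.

Lemma Newman_kernel : exists H : groupClosed B,
  [/\ normal_subgroup H, has_index H p.+1 & isomorphic N (subgroup H)].
Proof.
have [F [Fy Fx]] := Newman_hom.
have [rho [rho_a rho_b]] := BS_hom wreath_relation.
(* At [i = 0] and for [g] in the kernel, this says [F ((rho g).2 1) = g]. *)
have transfer := coord_transfer rho_a rho_b Fy Fx.
pose phi : UMagmaMorphism.type B C := @wreath_top N C \o rho.
pose H : groupClosed B := kernel phi.
exists H; split; first exact: kernel_normal.
  have := @kernel_index _ _ phi; rewrite card_ord; apply=> c.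
  by exists (a ^+ c); rewrite gmulfXn /= rho_a wreath_top_a Zp_gen_expg valZpK.
have rhoFy : rho (F y) = wreath_a ^- p.+1.
  by rewrite Fy gmulfXVn /= rho_a.
have rhoFx i : rho (F (x i)) = lconj wreath_b^-1 (wreath_a ^+ i).
  by rewrite Fx gmulf_lconj gmulfV gmulfXn /= rho_a rho_b.
have F_top n : wreath_top (rho (F n)) = 1.
  elim/pres_ind: n => [[i|]||m n IHm IHn|n IHn].
  - by rewrite rhoFx wreath_top_x.
  - by rewrite rhoFy wreath_top_y.
  - by rewrite !gmulf1.
  - by rewrite !gmulfM /= IHm IHn mulg1.
  - by rewrite !gmulfV /= IHn invg1.
have FK n : (rho (F n)).2 1 = n.
  elim/pres_ind: n => [[i|]||m n IHm IHn|n IHn].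
  - by rewrite rhoFx wreath_coord_x.
  - by rewrite rhoFy wreath_coord_y.
  - by rewrite !gmulf1 ffunE.
  - by rewrite !gmulfM wreath_coordM F_top mulg1 IHm IHn.
  - by rewrite !gmulfV wreath_coordV F_top invg1 mulg1 IHn.
apply: (isomorphic_image (F := F)).
- by move=> m n Fmn; rewrite -[m]FK Fmn FK.
- by move=> n; apply/eqP/F_top.
- move=> h /eqP /= h1; exists ((rho h).2 1).
  by rewrite transfer h1 mulg1 expg0 mul1g invg1 mulg1.
Qed.

End NewmanGroup.

Theorem proposition4p3 (p q : nat) (hp : (2 <= p)%N) (hq : (1 <= q)%N) :
  exists H : groupClosed (BS p 1%Z (Posz (p * q))),
    [/\ normal_subgroup H, has_index H p & isomorphic (NG p q) (subgroup H)].
Proof. by case: p hp => // p _; apply: Newman_kernel. Qed.
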